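(* Let $K$ be a field and $A = K[x_1,\dots,x_n]$. Let $F\in A^{2\times 2}$ with $\det(F) = p$, where $p\in K[x_1]$ is an irreducible polynomial. If $I_1(F) = A$, then $F$ is equivalent over $A$ to $\mathrm{diag}(1,p)$, i.e. there exist $U,V\in\mathrm{GL}_2(A)$ such that $F = U\,\mathrm{diag}(1,p)\,V$.
   Context: $I_1(F)$ denotes the ideal of $A$ generated by all $1\times 1$ minors (that is, all entries) of $F$. $\mathrm{GL}_2(A)$ is the group of invertible $2\times 2$ matrices over $A$. *)

(* Defs.v *)
From mathcomp Require Import all_boot all_order all_algebra.
From mathcomp Require Import mpoly.
Set Implicit Arguments.
Unset Strict Implicit.
Unset Printing Implicit Defensive.
Import GRing.Theory.
Local Open Scope ring_scope.

Definition ideal_gen (R : comNzRingType) (I : finType) (g : I -> R) (a : R) : Prop :=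
  exists c : I -> R, a = \sum_i c i * g i.

(* The 1 x 1 minors of a matrix are its entries. *)
Definition minors1_ideal (R : comNzRingType) (m n : nat) (F : 'M[R]_(m, n)) : R -> Prop :=
  ideal_gen (fun ij : 'I_m * 'I_n => F ij.1 ij.2).

Definition diag2 (R : comNzRingType) (a b : R) : 'M[R]_2 :=
  diag_mx (\row_(j < 2) if j == ord0 then a else b).

(* The inclusion K[x_1] -> K[x_1, ..., x_(n+1)], p |-> p(x_1); the variables of
   {mpoly K[n.+1]} are numbered from 0, so x_1 is 'X_ord0. *)
Definition in_first_var (K : fieldType) (n : nat) (p : {poly K}) : {mpoly K[n.+1]} :=
  (map_poly (@mpolyC n.+1 K) p).['X_ord0].

(* A and B are equivalent over R; GL_k(R) is the set unitmx of k x k matrices. *)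
Definition mx_equivalent (R : comUnitRingType) (m n : nat) (A B : 'M[R]_(m, n)) : Prop :=
  exists (U : 'M[R]_m) (V : 'M[R]_n),
    [/\ U \in unitmx, V \in unitmx & A = U *m B *m V].

(* Main.v *)
(* Write [A = C[y]] and call [c] in [C] good when [F(y + c z)] and [F(y)] are equivalent
   over [C[y, z]]; the good elements form an ideal of [C] (Quillen's patching argument), and
   if it contains 1 then [F] is equivalent to [F(0)], which has one variable less.  Whenever
   [w F v = s] is a constant, [s F = U diag(1, det F) V] with [det U = det V = s], and a
   Taylor expansion shows that [s] is good; in particular [p] is.  Suppose all good elements
   lie in a maximal ideal [m], with residue field [k].  Since [p] lies in the ideal of the
   first column of [F], the entries of that column may be reduced modulo [p], so that after a
   change of variables the column ideal contains a polynomial whose leading coefficient in [y]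
   is a nonzero element of [K[x_1]] of degree < deg [p], hence a unit modulo [m].  Then the gcd
   over [k[y]] of the first column lifts to an element [w F e_1] of the same degree with
   leading coefficient a unit modulo [m]; modulo [m] the row [w F] is unimodular because [F]
   has rank 1 and its entries generate the unit ideal.  Eliminating [y] gives [v] with [w F v]
   a constant outside [m], a contradiction.  With no variable left besides [x_1] the ring is
   principal. *)
Require Import Defs.
From HB Require Import structures.
From mathcomp Require Import all_boot all_order all_algebra.
From mathcomp Require Import mpoly ring_quotient generic_quotient.
From mathcomp Require boolp classical_sets.
From mathcomp Require Import ring.
Set Implicit Arguments.
Unset Strict Implicit.
Unset Printing Implicit Defensive.
Import GRing.Theory.
Local Open Scope ring_scope.

(** * Residue fields of maximal ideals *)

Definition is_ideal (R : comNzRingType) (I : R -> Prop) : Prop :=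
  [/\ I 0, forall x y, I x -> I y -> I (x + y) & forall a x, I x -> I (a * x)].

Definition is_maximal_ideal (R : comNzRingType) (M : R -> Prop) : Prop :=
  [/\ is_ideal M, ~ M 1 & forall x, ~ M x -> exists a b, M b /\ a * x + b = 1].

Lemma maximal_ideal_exists (R : comNzRingType) (J : R -> Prop) :
  is_ideal J -> ~ J 1 ->
  exists M, is_maximal_ideal M /\ forall x, J x -> M x.
Proof.
move=> idJ J1; pose good (A : R -> Prop) :=
  (* The union of the empty chain is empty, hence the first disjunct. *)
  (forall x, ~ A x) \/ [/\ is_ideal A, ~ A 1 & forall x, J x -> A x].
have [F Fgood Ftot|M [Mgood Mmax]] := @classical_sets.Zorn_bigcup R good.
  have [[A [FA [x0 Ax0]]]|noA] := boolp.EM (exists A, F A /\ exists x, A x).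
    have nonempty B y : F B -> B y ->
        [/\ is_ideal B, ~ B 1 & forall x, J x -> B x].
      by move=> FB By; have [/(_ y)|] := Fgood B FB.
    right; split; first split.
    - by exists A => //; have [[]] := nonempty A x0 FA Ax0.
    - move=> x y [B FB Bx] [C FC Cy].
      have [BC|CB] := Ftot B C FB FC.
        exists C => //; have [[_ addC _] _ _] := nonempty C y FC Cy.
        by apply: addC => //; apply: BC.
      exists B => //; have [[_ addB _] _ _] := nonempty B x FB Bx.
      by apply: addB => //; apply: CB.
    - move=> a x [B FB Bx]; exists B => //.
      by have [[_ _ mulB] _ _] := nonempty B x FB Bx; apply: mulB.
    - by move=> [B FB B1]; have [_ nB1 _] := nonempty B 1 FB B1; apply: nB1.
    - by move=> x Jx; exists A => //; have [_ _ JA] := nonempty A x0 FA Ax0; apply: JA.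
  by left=> x [B FB Bx]; apply: noA; exists B; split=> //; exists x.
have {Mgood} [M0|[idM M1 JM]] := Mgood.
  have [J0 _ _] := idJ; case: (Mmax J); last by right.
  by split=> [x /M0 //|/(_ 0 J0)]; apply: M0.
exists M; split=> //; split=> // x Mx; apply: boolp.contrapT => no_inv.
have [M0 addM mulM] := idM.
(* [Mx'] is the ideal [M + (x)]. It strictly contains [M], and it would be proper if [x] had no
   inverse modulo [M]. *)
pose Mx' y := exists a b, M b /\ a * x + b = y.
apply: (Mmax Mx').
  split=> [y My|]; first by exists 0, y; rewrite mul0r add0r.
  by move/(_ x) => h; apply/Mx/h; exists 1, 0; rewrite mul1r addr0.
right; split=> //.
  split; first by exists 0, 0; rewrite mul0r add0r.
  - move=> _ _ [a [b [Mb <-]]] [a' [b' [Mb' <-]]].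
    by exists (a + a'), (b + b'); split; [exact: addM|ring].
  - move=> c _ [a [b [Mb <-]]].
    by exists (c * a), (c * b); split; [exact: mulM|ring].
by move=> y Jy; exists 0, y; split; [exact: JM|ring].
Qed.

Section ResidueField.
Variables (R : comNzRingType) (M : R -> Prop) (maxM : is_maximal_ideal M).

(* The unused proof argument lets the ideal instance below depend on it. *)
Definition max_pred (maxM' : is_maximal_ideal M) (x : R) : bool := boolp.asbool (M x).

Fact max_pred_ideal : idealr_closed (max_pred maxM).
Proof.
have [[M0 addM mulM] M1 _] := maxM.
split; rewrite ?unfold_in; first exact/boolp.asboolP.
  by apply/negP => /boolp.asboolP.
move=> a u v; rewrite !unfold_in => /boolp.asboolP Mu /boolp.asboolP Mv.
by apply/boolp.asboolP/addM => //; apply: mulM.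
Qed.

HB.instance Definition _ := isIdealr.Build R (max_pred maxM) max_pred_ideal.

Definition max_idealr : idealr R := max_pred maxM.
Local Notation Q := {ideal_quot max_idealr}.

Lemma residue_eq0 (x : R) : (\pi_Q x%qT == 0 :> Q)%qT <-> M x.
Proof.
rewrite -(rmorph0 (\pi_Q)%qT) -Quotient.idealrBE subr0.
split=> [/boolp.asboolP //|Mx]; exact/boolp.asboolP.
Qed.

Fact residue_inv_ex (y : Q) : exists z : Q, if y == 0 then z = 0 else z * y = 1.
Proof.
have [_|y0] := eqVneq y 0; first by exists 0.
have [_ _ Minv] := maxM.
have [|a [b [Mb ab]]] := Minv (repr y).
  by move/residue_eq0; rewrite reprK; apply/negP.
exists (\pi_Q a)%qT; rewrite -[y]reprK -rmorphM.
apply/eqP; rewrite -subr_eq0 -(rmorph1 (\pi_Q)%qT) -rmorphB; apply/residue_eq0.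
have [[_ _ mulM] _ _] := maxM.
by rewrite -ab opprD addrA subrr sub0r -mulN1r; apply: mulM.
Qed.

Definition residue_inv (y : Q) : Q := sval (boolp.cid (residue_inv_ex y)).

Fact residue_mulVf (y : Q) : y != 0 -> residue_inv y * y = 1.
Proof.
by rewrite /residue_inv; case: boolp.cid => z /= + y0; rewrite (negbTE y0).
Qed.

Fact residue_inv0 : residue_inv 0 = 0.
Proof. by rewrite /residue_inv; case: boolp.cid => z /=; rewrite eqxx. Qed.

Definition residue_field : Type := Q.
HB.instance Definition _ := GRing.ComNzRing.on residue_field.
HB.instance Definition _ :=
  GRing.ComNzRing_isField.Build residue_field residue_mulVf residue_inv0.

End ResidueField.

Lemma residue_field_exists (R : comNzRingType) (J : R -> Prop) :
  is_ideal J -> ~ J 1 ->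
  exists (k : fieldType) (f : {rmorphism R -> k}),
    (forall y, exists x, f x = y) /\ forall x, J x -> f x = 0.
Proof.
move=> idJ J1; have [M [maxM JM]] := maximal_ideal_exists idJ J1.
exists (residue_field maxM), (\pi_{ideal_quot max_idealr maxM})%qT; split=> [y|x /JM Mx].
  by exists (repr (y : {ideal_quot max_idealr maxM})); apply: reprK.
by apply/eqP/residue_eq0.
Qed.

(** * Equivalence of 2 x 2 matrices and translations of a variable *)

Section Equivalence.
Variable R : comUnitRingType.

Lemma mx_equivalent_trans m n (A B C : 'M[R]_(m, n)) :
  mx_equivalent A B -> mx_equivalent B C -> mx_equivalent A C.
Proof.
move=> [U [V [uU uV ->]]] [U' [V' [uU' uV' ->]]].
by exists (U *m U'), (V' *m V); rewrite !unitmx_mul uU uU' uV uV' !mulmxA.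
Qed.

Lemma mx_equivalent_map (S : comUnitRingType) (f : {rmorphism R -> S}) m n
    (A B : 'M[R]_(m, n)) :
  mx_equivalent A B -> mx_equivalent (map_mx f A) (map_mx f B).
Proof.
move=> [U [V [uU uV ->]]]; exists (map_mx f U), (map_mx f V).
by rewrite !map_mxM; split=> //; rewrite unitmxE det_map_mx rmorph_unit // -unitmxE.
Qed.

End Equivalence.

Section Matrix2.
Variable R : comNzRingType.
Implicit Types a b c d : R.

Definition mx2 a b c d : 'M[R]_2 :=
  \matrix_(i, j) if i == 0 then if j == 0 then a else b
                 else if j == 0 then c else d.

Lemma ord2_cases (i : 'I_2) : i = 0 \/ i = 1.
Proof. by case: i => [[|[|//]] lt_i]; [left|right]; apply: val_inj. Qed.

Lemma mx2E (F : 'M[R]_2) : F = mx2 (F 0 0) (F 0 1) (F 1 0) (F 1 1).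
Proof.
apply/matrixP=> i j; rewrite mxE.
by have [-> | ->] := ord2_cases i; have [-> | ->] := ord2_cases j.
Qed.

Lemma mulmx2 a b c d a' b' c' d' :
  mx2 a b c d *m mx2 a' b' c' d' =
  mx2 (a * a' + b * c') (a * b' + b * d') (c * a' + d * c') (c * b' + d * d').
Proof.
apply/matrixP=> i j; rewrite !mxE !big_ord_recl big_ord0 !mxE /= addr0.
by have [-> | ->] := ord2_cases i; have [-> | ->] := ord2_cases j.
Qed.

Lemma scale_mx2 k a b c d : k *: mx2 a b c d = mx2 (k * a) (k * b) (k * c) (k * d).
Proof.
apply/matrixP=> i j; rewrite !mxE.
by have [-> | ->] := ord2_cases i; have [-> | ->] := ord2_cases j.
Qed.

Lemma det_mx2 a b c d : \det (mx2 a b c d) = a * d - b * c.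
Proof.
rewrite (expand_det_row _ 0) !big_ord_recl big_ord0 /cofactor !det_mx11 !mxE /=.
by rewrite !(expr0, expr1, mul1r, mulN1r, addr0) mulrN.
Qed.

Lemma det_ord2 (F : 'M[R]_2) : \det F = F 0 0 * F 1 1 - F 0 1 * F 1 0.
Proof. by rewrite {1}[F]mx2E det_mx2. Qed.

Lemma diag2E a b : diag2 a b = mx2 a 0 0 b.
Proof.
apply/matrixP=> i j; rewrite !mxE.
by have [-> | ->] := ord2_cases i; have [-> | ->] := ord2_cases j;
  rewrite /= ?mulr1n ?mulr0n.
Qed.

(** The matrix [(w F v) F - (F v)(w F)] is killed by [w] on the left and by [v] on the right; it
    equals [det F] times the column [(-w2, w1)] times the row [(-v2, v1)]. Both outer factors have
    determinant [w F v]. *)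
Lemma sandwich_factorization (F : 'M[R]_2) (w1 w2 v1 v2 : R) :
  let g1 := w1 * F 0 0 + w2 * F 1 0 in let g2 := w1 * F 0 1 + w2 * F 1 1 in
  let f1 := F 0 0 * v1 + F 0 1 * v2 in let f2 := F 1 0 * v1 + F 1 1 * v2 in
  let s := g1 * v1 + g2 * v2 in
  [/\ s *: F = mx2 f1 (- w2) f2 w1 *m diag2 1 (\det F) *m mx2 g1 g2 (- v2) v1,
      \det (mx2 f1 (- w2) f2 w1) = s & \det (mx2 g1 g2 (- v2) v1) = s].
Proof.
move=> g1 g2 f1 f2 s.
rewrite det_ord2 diag2E !mulmx2 !det_mx2 {1}[F]mx2E scale_mx2 /s /g1 /g2 /f1 /f2.
by split; [congr mx2| |]; ring.
Qed.

End Matrix2.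

Lemma mx_equivalent_diag (R : comUnitRingType) (F : 'M[R]_2) (w1 w2 v1 v2 : R) :
  (w1 * F 0 0 + w2 * F 1 0) * v1 + (w1 * F 0 1 + w2 * F 1 1) * v2 = 1 ->
  mx_equivalent F (diag2 1 (\det F)).
Proof.
have [] := sandwich_factorization F w1 w2 v1 v2.
move=> eF dU dV s1; rewrite s1 in eF dU dV.
exists (mx2 (F 0 0 * v1 + F 0 1 * v2) (- w2) (F 1 0 * v1 + F 1 1 * v2) w1).
exists (mx2 (w1 * F 0 0 + w2 * F 1 0) (w1 * F 0 1 + w2 * F 1 1) (- v2) v1).
by rewrite !unitmxE dU dV unitr1 -eF scale1r.
Qed.

(* If [s F = U D V] and [s F' = U' D V'], then formally [F' = (U' U^-1) F (V^-1 V')]. *)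
Lemma mx_equivalent_lift (R : idomainType) (n : nat) (s : R)
    (F F' U V U' V' D EU EV : 'M[R]_n) : s != 0 ->
  s *: F = U *m D *m V -> s *: F' = U' *m D *m V' ->
  \det U = s -> \det U' = s -> \det V = s -> \det V' = s ->
  s *: EU = U' *m \adj U -> s *: EV = \adj V *m V' ->
  mx_equivalent F' F.
Proof.
move=> s0 eF eF' dU dU' dV dV' eEU eEV.
have sK (A B : 'M[R]_n) : s *: A = s *: B -> A = B.
  move/matrixP=> eAB; apply/matrixP=> i j.
  by have := eAB i j; rewrite !mxE; apply: mulfI.
(* Both [s^n * det E] and [det B * det (adj B)] equal [s^n]; cancelling this power gives
   [det E = 1]. *)
have detE (E A B : 'M[R]_n) : \det A = s -> \det B = s ->
    s *: E = A *m \adj B \/ s *: E = \adj B *m A -> \det E = 1.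
  move=> dA dB eE; apply: (mulfI (expf_neq0 n s0)); rewrite mulr1 -detZ.
  have -> : \det (s *: E) = s * \det (\adj B).
    by case: eE => ->; rewrite det_mulmx dA // mulrC.
  by rewrite -{1}dB -det_mulmx mul_mx_adj dB det_scalar.
exists EU, EV; split.
- by rewrite unitmxE (detE _ U' U) ?unitr1 //; left.
- by rewrite unitmxE (detE _ V' V) ?unitr1 //; right.
(* One factor [s] is spent on each of [EU], [F] and [EV]. *)
apply/sK/sK/sK.
have -> : s *: (s *: (s *: (EU *m F *m EV))) = (s *: EU) *m (s *: F) *m (s *: EV).
  by rewrite -!scalemxAr -!scalemxAl.
rewrite eEU eF eEV !mulmxA -[U' *m \adj U *m U]mulmxA mul_adj_mx dU.
rewrite mul_mx_scalar -!scalemxAl -[_ *m V *m \adj V]mulmxA mul_mx_adj dV.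
by rewrite mul_mx_scalar -!scalemxAl eF'.
Qed.

(** * Quillen's ideal of good elements *)

Section Homotopy.
Variable C : idomainType.
Implicit Types (f : {poly C}) (F : 'M[{poly C}]_2) (c : C).

(* In [{poly {poly C}}] the outer variable is [y] and the inner one [z];
   [translate c] maps [f(y)] to [f(y + c z)]. *)
Definition translate c : {poly C} -> {poly {poly C}} :=
  comp_poly ('X + (c *: 'X)%:P) \o map_poly polyC.
HB.instance Definition _ c := 
  GRing.RMorphism.copy (translate c) (comp_poly ('X + (c *: 'X)%:P) \o map_poly polyC).

Lemma translateX c : translate c 'X = 'X + (c *: 'X)%:P.
Proof. by rewrite /translate /= map_polyX comp_polyX. Qed.

Lemma translateC c a : translate c a%:P = a%:P%:P.
Proof. by rewrite /translate /= map_polyC comp_polyC. Qed.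

Lemma poly_rmorph_ext (R : nzRingType) (S : nzRingType) (f g : {rmorphism {poly R} -> S}) :
  (forall a, f a%:P = g a%:P) -> f 'X = g 'X -> f =1 g.
Proof.
move=> eqC eqX; elim/poly_ind=> [|p a IHp]; first by rewrite !rmorph0.
by rewrite !rmorphD !rmorphM /= IHp eqX eqC.
Qed.

Lemma translate0 : translate 0 =1 map_poly polyC.
Proof.
apply: poly_rmorph_ext => [a|]; first by rewrite /= translateC map_polyC.
by rewrite /= translateX scale0r addr0 map_polyX.
Qed.

Lemma translate_taylor c f : exists g,
  translate c f = map_poly polyC f + (c *: 'X)%:P * g.
Proof.
rewrite /translate /=; elim/poly_ind: (map_poly _ f) => [|p a [g IHp]].
  by exists 0; rewrite comp_poly0 mulr0 addr0.
exists (p + g * 'X + (c *: 'X)%:P * g).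
by rewrite comp_polyD comp_polyM comp_polyX comp_polyC IHp; ring.
Qed.

Lemma translate_taylor_mx c (U : 'M[{poly C}]_2) : exists G,
  map_mx (translate c) U = map_mx (map_poly polyC) U + (c *: 'X)%:P *: G.
Proof.
have [g eg] := boolp.choice (translate_taylor c).
exists (map_mx g U); apply/matrixP=> i j; rewrite !mxE; exact: eg.
Qed.

Definition translation_equivalent F c : Prop :=
  mx_equivalent (map_mx (translate c) F) (map_mx (map_poly polyC) F).

(** For a sum, substituting [y + c z] for [y] in the equivalence for [c'] relates
    [F(y + (c + c') z)] to [F(y + c z)]. For a multiple, substitute [a z] for [z]. *)
Lemma translation_equivalent_ideal F : is_ideal (translation_equivalent F).
Proof.
split=> [|c c' Fc Fc'|a c Fc]; rewrite /translation_equivalent.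
- have -> : map_mx (translate 0) F = map_mx (map_poly polyC) F.
    by apply/matrixP=> i j; rewrite !mxE translate0.
  by exists 1%:M, 1%:M; rewrite !unitmx1 mul1mx mulmx1.
- apply: mx_equivalent_trans Fc.
  have := mx_equivalent_map (comp_poly ('X + (c *: 'X)%:P)) Fc'.
  rewrite -!map_mx_comp.
  have -> : map_mx (comp_poly ('X + (c *: 'X)%:P) \o translate c') F =
            map_mx (translate (c + c')) F.
    apply: eq_map_mx; apply: poly_rmorph_ext => [b|] /=.
      by rewrite !translateC comp_polyC.
    rewrite !translateX comp_polyD comp_polyX comp_polyC.
    by rewrite scalerDl polyCD addrA.
  done.
have := mx_equivalent_map (map_poly (comp_poly (a *: 'X))) Fc.
rewrite -!map_mx_comp.
have -> : map_mx (map_poly (comp_poly (a *: 'X)) \o translate c) F =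
          map_mx (translate (a * c)) F.
  apply: eq_map_mx; apply: poly_rmorph_ext => [b|] /=.
    by rewrite !translateC map_polyC /= comp_polyC.
  rewrite !translateX rmorphD /= map_polyX map_polyC /= linearZ /= comp_polyX.
  by rewrite scalerA mulrC.
have -> // : map_mx (map_poly (comp_poly (a *: 'X)) \o map_poly polyC) F =
          map_mx (map_poly polyC) F.
apply: eq_map_mx; apply: poly_rmorph_ext => [b|] /=.
  by rewrite !map_polyC /= comp_polyC.
by rewrite !map_polyX.
Qed.

(** Setting [y = 0] in the equivalence of [F(y + z)] and [F(y)] leaves [z] as the variable. *)
Lemma translation_equivalent1 F :
  translation_equivalent F 1 -> mx_equivalent F (map_mx (fun f => f.[0]%:P) F).
Proof.
move/(mx_equivalent_map (horner_eval 0)); rewrite -!map_mx_comp.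
have -> : map_mx (horner_eval 0 \o translate 1) F = F.
  apply/matrixP=> i j; rewrite mxE; apply: (poly_rmorph_ext (g := idfun)) => [b|] /=.
    by rewrite translateC /horner_eval hornerC.
  by rewrite translateX /horner_eval hornerD hornerX hornerC add0r scale1r.
have -> // : map_mx (horner_eval 0 \o map_poly polyC) F = map_mx (fun f => f.[0]%:P) F.
by apply: eq_map_mx => f /=; rewrite /horner_eval -[0]/(0%:P) horner_map.
Qed.

Lemma translation_equivalent_sandwich F (w1 w2 v1 v2 : {poly C}) (p s : C) :
  \det F = p%:P ->
  (w1 * F 0 0 + w2 * F 1 0) * v1 + (w1 * F 0 1 + w2 * F 1 1) * v2 = s%:P ->
  translation_equivalent F s.
Proof.
move=> detF; have [J0 _ _] := translation_equivalent_ideal F.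
have [-> //|s0] := eqVneq s 0.
have [] := sandwich_factorization F w1 w2 v1 v2.
set U := mx2 _ _ _ w1; set V := mx2 _ _ _ v1 => eF dU dV es.
rewrite es in eF dU dV.
have eqT c : s%:P%:P *: map_mx (translate c) F =
    map_mx (translate c) U *m diag2 1 p%:P%:P *m map_mx (translate c) V.
  have := congr1 (map_mx (translate c)) eF.
  rewrite map_mxZ /= translateC !map_mxM /= detF !diag2E => ->.
  congr (_ *m _ *m _); apply/matrixP=> i j; rewrite !mxE.
  by case: (i == 0); case: (j == 0); rewrite ?rmorph0 ?rmorph1 // translateC.
have dT c W : \det W = s%:P -> \det (map_mx (translate c) W) = s%:P%:P.
  by move=> dW; rewrite det_map_mx dW /= translateC.
have e0 W : map_mx (translate 0) W = map_mx (map_poly polyC) W.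
  by apply: eq_map_mx; apply: translate0.
have [GU eU] := translate_taylor_mx s U; have [GV eV] := translate_taylor_mx s V.
rewrite /translation_equivalent -e0.
have esX : (s *: 'X)%:P = s%:P%:P * 'X%:P :> {poly {poly C}}.
  by rewrite -mul_polyC polyCM.
(* By Taylor, [U(y + s z) = U(y) + s z GU], so [U(y + s z) adj U(y) = s (1 + z GU adj U(y))]. The
   division by [s] is exact and yields [EU]; [EV] arises in the same way. *)
apply: (mx_equivalent_lift (s := s%:P%:P) _ (eqT 0) (eqT s)
  (EU := 1%:M + 'X%:P *: (GU *m \adj (map_mx (translate 0) U)))
  (EV := 1%:M + 'X%:P *: (\adj (map_mx (translate 0) V) *m GV))); rewrite ?dT //.
- by rewrite !polyC_eq0.
- rewrite eU esX -e0 mulmxDl mul_mx_adj dT // scalerDr scale_scalar_mx mulr1.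
  by rewrite scalerA -scalemxAl.
rewrite eV esX -e0 mulmxDr mul_adj_mx dT // scalerDr scale_scalar_mx mulr1.
by rewrite scalerA -scalemxAr.
Qed.

End Homotopy.

(** * Elimination over a maximal ideal *)

Lemma sum_pairs2 (V : nmodType) (f : 'I_2 * 'I_2 -> V) :
  \sum_ij f ij = f (0, 0) + f (0, 1) + (f (1, 0) + f (1, 1)).
Proof.
rewrite (eq_bigr (fun ij => f (ij.1, ij.2))) => [|[i j] _ //].
rewrite -(pair_bigA _ (fun i j => f (i, j))) /= !big_ord_recl !big_ord0 /= !addr0.
by congr (_ + f (_, _) + (f (_, _) + f (_, _))); apply: val_inj.
Qed.

Section MonicElimination.
Variables (C : idomainType) (k : fieldType) (pi : {rmorphism C -> k}).
Local Notation "f ^pi" := (map_poly pi f) (at level 2, format "f ^pi").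

Lemma unit_lead_size_map (f : {poly C}) : pi (lead_coef f) != 0 -> size f^pi = size f.
Proof. exact: size_map_poly_id0. Qed.

(* Dividing [X^(d-1-r) f1] by [f0] leaves a remainder of degree exactly [d - 1]. *)
Lemma ideal_lower_degree (I : {poly C} -> Prop) (f0 f1 : {poly C}) (r d : nat) :
  is_ideal I -> I f0 -> I f1 -> size f0 = d.+1 -> pi (lead_coef f0) != 0 ->
  size f1^pi = r.+1 -> (r <= d)%N ->
  exists g, [/\ I g, size g = r.+1 & pi (lead_coef g) != 0].
Proof.
move=> [_ addI mulI] + If1 + + sf1.
elim: d f0 => [|d IHd] f0 If0 sf0 lf0; first by rewrite leqn0 => /eqP ->; exists f0.
rewrite leq_eqVlt => /predU1P[->|]; first by exists f0.
rewrite ltnS => le_rd; pose h := f1 * 'X^(d - r).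
have nz_f1 : f1^pi != 0 by rewrite -size_poly_eq0 sf1.
have sh : size h^pi = d.+1.
  rewrite rmorphM /= map_polyXn size_mulXn ?nz_f1 // sf1 addnS subnK //.
have eh := Pdiv.Idomain.divp_eq h f0.
set l := lead_coef f0 ^+ _ in eh; set q := (h %/ f0)%R in eh; set g := (h %% f0)%R in eh.
have lt_g : (size g <= d.+1)%N.
  by rewrite -ltnS -sf0 Pdiv.Idomain.ltn_modp -size_poly_eq0 sf0.
have l0 : pi l != 0 by rewrite rmorphXn expf_neq0.
have eh' : pi l *: h^pi = q^pi * f0^pi + g^pi.
  by rewrite -rmorphM -rmorphD -eh /= map_polyZ.
(* Modulo [pi], [f0] keeps its size [d.+2], while [l h - g] has size at most [d.+1]. Hence the
   pseudo-quotient vanishes and [g] reduces to a unit multiple of the reduction of [h]. *)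
have q0 : q^pi = 0.
  apply/eqP/negPn/negP=> q0.
  have nz_f0 : f0^pi != 0 by rewrite -size_poly_eq0 unit_lead_size_map // sf0.
  have : (size (q^pi * f0^pi)%R <= d.+1)%N.
    rewrite (canRL (addrK _) (esym eh')) (leq_trans (size_polyD _ _)) // size_polyN.
    by rewrite geq_max size_scale // sh leqnn (leq_trans (size_poly _ _)).
  rewrite size_mul // (unit_lead_size_map lf0) sf0 addnS /=.
  by rewrite leqNgt addnS ltnS -[X in (X < _)%N]add0n ltn_add2r size_poly_gt0 q0.
have sg : size g^pi = d.+1 by rewrite -sh -(size_scale h^pi l0) eh' q0 mul0r add0r.
have {lt_g} sg' : size g = d.+1.
  by apply/eqP; rewrite eqn_leq lt_g -sg size_poly.
have lg : pi (lead_coef g) != 0.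
  rewrite lead_coefE sg' -coef_map /= -[d]/(d.+1.-1) -sg -lead_coefE.
  by rewrite lead_coef_eq0 -size_poly_eq0 sg.
apply: (IHd g) => //.
have -> : g = - q * f0 + (l%:P * 'X^(d - r)) * f1.
  by apply: (addrI (q * f0)); rewrite -eh -mul_polyC /h; ring.
by apply: addI; apply: mulI.
Qed.

Definition ideal2 (R : comNzRingType) (a b : R) (x : R) : Prop :=
  exists u v, x = u * a + v * b.

Lemma ideal2_ideal (R : comNzRingType) (a b : R) : is_ideal (ideal2 a b).
Proof.
split; first by exists 0, 0; ring.
  by move=> _ _ [u [v ->]] [u' [v' ->]]; exists (u + u'), (v + v'); ring.
by move=> c _ [u [v ->]]; exists (c * u), (c * v); ring.
Qed.

Section LocalSandwich.
Hypothesis pi_surj : forall y, exists x, pi x = y.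

Lemma map_poly_surj (f : {poly k}) : exists g : {poly C}, g^pi = f.
Proof.
elim/poly_ind: f => [|f a [g IHg]]; first by exists 0; rewrite rmorph0.
have [b eb] := pi_surj a; exists (g * 'X + b%:P).
by rewrite rmorphD rmorphM /= map_polyX map_polyC IHg /= eb.
Qed.

Lemma local_sandwich (F : 'M[{poly C}]_2) (p : C) (u v : {poly C}) :
  minors1_ideal F 1 -> \det F = p%:P -> pi p = 0 ->
  pi (lead_coef (u * F 0 0 + v * F 1 0)) != 0 ->
  exists w1 w2 v1 v2 s, pi s != 0 /\
    (w1 * F 0 0 + w2 * F 1 0) * v1 + (w1 * F 0 1 + w2 * F 1 1) * v2 = s%:P.
Proof.
move=> I1 detF pi_p lf0; set f0 := u * _ + _ in lf0.
have detF_pi : (F 0 0)^pi * (F 1 1)^pi = (F 0 1)^pi * (F 1 0)^pi.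
  apply/eqP; rewrite -subr_eq0 -!rmorphM -rmorphB -det_ord2 detF /=.
  by rewrite map_polyC /= pi_p.
have [c ec] : exists c : 'I_2 -> 'I_2 -> {poly C},
    1 = (c 0 0)^pi * (F 0 0)^pi + (c 0 1)^pi * (F 0 1)^pi +
        ((c 1 0)^pi * (F 1 0)^pi + (c 1 1)^pi * (F 1 1)^pi).
  have [c ec] := I1; exists (fun i j => c (i, j)).
  rewrite -(rmorph1 (map_poly pi)) ec sum_pairs2 /=.
  by rewrite !rmorphD !rmorphM /= !addrA.
have nz_f0 : f0^pi != 0.
  rewrite -size_poly_eq0 (unit_lead_size_map lf0) size_poly_eq0.
  by apply: contraNneq lf0 => ->; rewrite lead_coef0 rmorph0.
set a := (F 0 0)^pi in detF_pi ec; set b := (F 1 0)^pi in detF_pi ec.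
have [[x y] /= exy] := Pdiv.Field.Bezoutp a b.
have [X eX] := map_poly_surj x; have [Y eY] := map_poly_surj y.
have /andP[dvd_gcd gcd_dvd] := exy.
have dvd_f0 : x * a + y * b %| f0^pi.
  rewrite (dvdp_trans dvd_gcd) // rmorphD !rmorphM /=.
  by rewrite dvdp_add // dvdp_mull ?dvdp_gcdl ?dvdp_gcdr.
have nz_xy : x * a + y * b != 0.
  by apply: contraNneq nz_f0 => xy0; rewrite -dvd0p -xy0.
(* A coefficientwise lift of the gcd may have larger degree; descending from [f0] gives an element
   of the column ideal with the degree of the gcd and a unit leading coefficient modulo [pi]. *)
have [_ [[w1 [w2 ->]] sg lg]] : exists g, [/\ ideal2 (F 0 0) (F 1 0) g,
    size g = (size (x * a + y * b)).-1.+1 & pi (lead_coef g) != 0].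
  apply: (@ideal_lower_degree _ f0 (X * F 0 0 + Y * F 1 0) _ (size f0).-1) => //.
  - exact: ideal2_ideal.
  - by exists u, v.
  - by exists X, Y.
  - by rewrite prednK // lt0n size_poly_eq0; apply: contraNneq nz_f0 => ->; rewrite rmorph0.
  - by rewrite rmorphD !rmorphM /= eX eY prednK // size_poly_gt0.
  - by rewrite -(unit_lead_size_map lf0) -!subn1 leq_sub2r // dvdp_leq.
rewrite prednK ?size_poly_gt0 // in sg.
set g := w1 * _ + _ in sg lg *.
have eg : g^pi = w1^pi * a + w2^pi * b by rewrite rmorphD !rmorphM.
have nz_g : g^pi != 0 by rewrite -size_poly_eq0 (unit_lead_size_map lg) sg size_poly_eq0.
(* A multiple of the gcd of the same size is associated to it. *)
have g_dvd : g^pi %| gcdp a b.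
  rewrite -(eqp_dvdr _ exy).
  have dvd_g : x * a + y * b %| g^pi.
    rewrite (dvdp_trans dvd_gcd) // eg.
    by rewrite dvdp_add // dvdp_mull ?dvdp_gcdl ?dvdp_gcdr.
  have := dvdp_size_eqp dvd_g.
  by rewrite (unit_lead_size_map lg) sg eqxx => /esym/andP[].
have /dvdpP[a1 ea] : g^pi %| a by rewrite (dvdp_trans g_dvd) // dvdp_gcdl.
have /dvdpP[b1 eb] : g^pi %| b by rewrite (dvdp_trans g_dvd) // dvdp_gcdr.
have w_unim : w1^pi * a1 + w2^pi * b1 = 1.
  by apply: (mulIf nz_g); rewrite mul1r mulrDl -!mulrA -ea -eb -eg.
(* The determinant vanishes modulo [pi], so the second column is proportional to [(a1, b1)]. With
   [w (a1, b1) = 1], the reduction of [F] becomes the column [(a1, b1)] times the row [(g, e)]. *)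
have cross : a1 * (F 1 1)^pi = (F 0 1)^pi * b1.
  by apply: (mulIf nz_g); rewrite mulrAC -ea detF_pi eb; ring.
pose e := w1 * F 0 1 + w2 * F 1 1.
have ee : e^pi = w1^pi * (F 0 1)^pi + w2^pi * (F 1 1)^pi by rewrite rmorphD !rmorphM.
have e01 : (F 0 1)^pi = a1 * e^pi.
  have -> : a1 * e^pi = w1^pi * a1 * (F 0 1)^pi + w2^pi * (a1 * (F 1 1)^pi).
    by rewrite ee; ring.
  by rewrite cross -{1}[(F 0 1)^pi]mul1r -w_unim; ring.
have e11 : (F 1 1)^pi = b1 * e^pi.
  have -> : b1 * e^pi = w1^pi * ((F 0 1)^pi * b1) + w2^pi * b1 * (F 1 1)^pi.
    by rewrite ee; ring.
  by rewrite -cross -{1}[(F 1 1)^pi]mul1r -w_unim; ring.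
(* Inserting this rank 1 form into the relation that expresses 1 by the entries of [F] gives the
   coefficients that make [(g, e)] unimodular modulo [pi]. *)
have [v1 ev1] := map_poly_surj ((c 0 0)^pi * a1 + (c 1 0)^pi * b1).
have [v2 ev2] := map_poly_surj ((c 0 1)^pi * a1 + (c 1 1)^pi * b1).
(* Since [v1 * g + v2 * e] reduces to 1, the descent from [g] ends in degree 0: this eliminates
   [y]. *)
have [_ [[t1 [t2 ->]] st lt]] : exists h, [/\ ideal2 g e h, size h = 1 & pi (lead_coef h) != 0].
  apply: (@ideal_lower_degree _ g (v1 * g + v2 * e) _ (size g).-1) => //.
  - exact: ideal2_ideal.
  - by exists 1, 0; ring.
  - by exists v1, v2.
  - by rewrite prednK // sg size_poly_gt0.
  rewrite rmorphD !rmorphM /= ev1 ev2.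
  have -> : ((c 0 0)^pi * a1 + (c 1 0)^pi * b1) * g^pi +
     ((c 0 1)^pi * a1 + (c 1 1)^pi * b1) * e^pi = 1.
    by rewrite [RHS]ec ea eb e01 e11; ring.
  by rewrite size_poly1.
have /size_poly1P[s s0 es] : size (t1 * g + t2 * e) == 1 by rewrite st.
exists w1, w2, t1, t2, s; split; first by move: lt; rewrite es lead_coefC.
by rewrite -es -/g -/e; ring.
Qed.

End LocalSandwich.
End MonicElimination.

(** If the good elements formed a proper ideal, some residue field would kill them all, [p]
    included. The Bezout relation then makes the leading coefficient nonzero there, and
    [local_sandwich] produces a good [s] that is not killed. *)
Lemma equivalent_eval0 (C : idomainType) (F : 'M[{poly C}]_2) (p : C) (u v : {poly C}) :
  minors1_ideal F 1 -> \det F = p%:P ->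
  (exists a b, a * lead_coef (u * F 0 0 + v * F 1 0) + b * p = 1) ->
  mx_equivalent F (map_mx (fun f => f.[0]%:P) F).
Proof.
move=> I1 detF [a [b ab]]; apply: translation_equivalent1; apply: boolp.contrapT => J1.
have [k [pi [pi_surj piJ]]] := residue_field_exists (translation_equivalent_ideal F) J1.
have pi_p : pi p = 0.
  (* Here [v] is the first column of the adjugate, so [w F v = det F] for [w = (1, 0)]. *)
  apply/piJ/(@translation_equivalent_sandwich _ _ 1 0 (F 1 1) (- F 1 0) _ _ detF).
  by rewrite -detF det_ord2; ring.
have pi_l : pi (lead_coef (u * F 0 0 + v * F 1 0)) != 0.
  apply/eqP=> l0; have := rmorph1 pi; rewrite -ab rmorphD !rmorphM /= l0 pi_p !mulr0 addr0.
  by move/eqP; rewrite eq_sym oner_eq0.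
have [w1 [w2 [v1 [v2 [s [/eqP pi_s es]]]]]] := local_sandwich pi_surj I1 detF pi_p pi_l.
by apply/pi_s/piJ/(translation_equivalent_sandwich detF es).
Qed.

(** * Change of variables and induction *)

Lemma map_diag2 (R S : comNzRingType) (f : {rmorphism R -> S}) a b :
  map_mx f (diag2 a b) = diag2 (f a) (f b).
Proof. by apply/matrixP=> i j; rewrite !mxE rmorphMn; case: ifP. Qed.

(** This quarter turn of determinant 1 brings the second column to the front. *)
Lemma minors1_ideal_rot_cols (R : comNzRingType) (F : 'M[R]_2) :
  minors1_ideal F 1 -> minors1_ideal (F *m mx2 0 (-1) 1 0) 1.
Proof.
move=> [c e1].
exists (fun ij => if ij.2 == 0 then c (ij.1, 1) else - c (ij.1, 0)).
have -> : F *m mx2 0 (-1) 1 0 = mx2 (F 0 1) (- F 0 0) (F 1 1) (- F 1 0).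
  by rewrite {1}[F]mx2E mulmx2; congr mx2; ring.
by rewrite e1 !sum_pairs2 !mxE /=; ring.
Qed.

Section Transport.
Variables (R S : comUnitRingType).

Lemma minors1_ideal_map (f : {rmorphism R -> S}) m n (F : 'M[R]_(m, n)) :
  minors1_ideal F 1 -> minors1_ideal (map_mx f F) 1.
Proof.
move=> [c e1]; exists (f \o c); rewrite -(rmorph1 f) e1 rmorph_sum /=.
by apply: eq_bigr => ij _; rewrite rmorphM mxE.
Qed.

Lemma mx_equivalent_transport (f : {rmorphism R -> S}) (g : {rmorphism S -> R})
    (F : 'M[R]_2) (p : R) : cancel f g ->
  mx_equivalent (map_mx f F) (diag2 1 (f p)) -> mx_equivalent F (diag2 1 p).
Proof.
move=> fK /(mx_equivalent_map g); rewrite map_diag2 rmorph1 fK -map_mx_comp.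
by rewrite (eq_map_mx _ fK) map_mx_id.
Qed.

End Transport.

(** The gcd of the first column divides [p], so it is a unit or associated to [p]; in both cases
    some [w F] is a unimodular row. *)
Lemma irreducible_diag2 (K : fieldType) (p : {poly K}) (F : 'M[{poly K}]_2) :
  irreducible_poly p -> \det F = p -> mx_equivalent F (diag2 1 p).
Proof.
move=> [p1 irr_p] detF; rewrite -detF.
set a := F 0 0; set b := F 1 0; set c := F 0 1; set d := F 1 1.
have {}detF : p = a * d - c * b by rewrite -detF det_ord2.
have [[x y] /= exy] := Pdiv.Field.Bezoutp a b.
have /dvdpP[a1 ea] : x * a + y * b %| a by rewrite (eqp_dvdl _ exy) dvdp_gcdl.
have /dvdpP[b1 eb] : x * a + y * b %| b by rewrite (eqp_dvdl _ exy) dvdp_gcdr.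
set g := x * a + y * b in ea eb.
have ep : p = (a1 * d - c * b1) * g by rewrite detF {1}ea {1}eb; ring.
have p0 : p != 0 by rewrite -size_poly_gt0 ltnW.
have [/size_poly1P[t t0 et]|g1] := boolP (size g == 1).
  apply: (@mx_equivalent_diag _ F x y t^-1%:P 0); rewrite -/a -/b -/g et.
  by rewrite -polyCM mulfV // mulr0 addr0.
have /eqp_size sg : g %= p by apply: irr_p => //; rewrite ep dvdp_mull.
have /size_poly1P[t t0 et] : size (a1 * d - c * b1) == 1.
  have [t0 g0] : a1 * d - c * b1 != 0 /\ g != 0 by apply/andP; rewrite -negb_or -mulf_eq0 -ep.
  have := congr1 (fun q : {poly K} => size q) ep; rewrite size_mul // sg.
  have : (0 < size p)%N by rewrite size_poly_gt0.
  case: (size p) => // n _; rewrite addnS /= => /eqP.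
  by rewrite -[X in X == _]add1n eqn_add2r eq_sym.
(* The row [(-b1, a1)] annihilates the first column and sends the second to the unit [t]. *)
apply: (@mx_equivalent_diag _ F (- b1) a1 0 t^-1%:P); rewrite -/a -/b -/c -/d.
have -> : - b1 * c + a1 * d = t%:P by rewrite -et; ring.
by rewrite -polyCM mulfV // mulr0 add0r.
Qed.

Lemma mpoly_rmorph_ext n (R S : comNzRingType) (f g : {rmorphism {mpoly R[n]} -> S}) :
  (forall c, f c%:MP = g c%:MP) -> (forall i, f 'X_i = g 'X_i) -> f =1 g.
Proof.
move=> eqC eqX q; rewrite (mpolyE q) !rmorph_sum; apply: eq_bigr => m _.
by rewrite -mul_mpolyC !rmorphM eqC mpolyXE_id !rmorph_prod;
  congr (_ * _); apply: eq_bigr => i _; rewrite !rmorphXn eqX.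
Qed.

(** * Nagata's change of variables *)

Lemma base_digits_inj N n (a b : 'I_n -> nat) :
  (forall i, a i < N)%N -> (forall i, b i < N)%N ->
  (\sum_(i < n) a i * N ^ i = \sum_(i < n) b i * N ^ i)%N -> a =1 b.
Proof.
elim: n a b => [|n IHn] a b aN bN; first by move=> _ [].
have step c : (\sum_(i < n.+1) c i * N ^ i =
    c ord0 + (\sum_(i < n) c (lift ord0 i) * N ^ i) * N)%N.
  rewrite big_ord_recl expn0 muln1 big_distrl /=; congr (_ + _)%N.
  by apply: eq_bigr => i _; rewrite -mulnA -expnSr.
rewrite !step => e; have N0 : (0 < N)%N by apply: leq_ltn_trans (aN ord0).
have e0 : a ord0 = b ord0.
  by have := congr1 (modn^~ N) e; rewrite ![(_ + _ * N)%N]addnC !modnMDl !modn_small.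
move: e; rewrite e0 => /addnI/eqP; rewrite eqn_pmul2r // => /eqP e i.
have [j ->|->] := unliftP ord0 i; last exact: e0.
by apply: (IHn (a \o lift ord0) (b \o lift ord0)) => [k|k|] /=; [exact: aN|exact: bN|].
Qed.

Section Coordinates.
Variables (D : idomainType) (n N : nat).

(** Variable 0 becomes [y], and each later one is shifted by a power of [y] whose exponent grows
    with its index, so that degrees in [y] separate monomials with exponents below [N]. *)
Definition coord_shift (i : 'I_n.+1) : {poly {mpoly D[n]}} :=
  if unlift ord0 i is Some j then 'X^(N ^ i) + ('X_j)%:P else 'X.

Definition to_poly : {mpoly D[n.+1]} -> {poly {mpoly D[n]}} :=
  mmap (polyC \o @mpolyC n D) coord_shift.
HB.instance Definition _ := GRing.RMorphism.copy to_poly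
  (mmap (polyC \o @mpolyC n D) coord_shift).

Definition of_mpoly : {mpoly D[n]} -> {mpoly D[n.+1]} :=
  mmap (@mpolyC n.+1 D) (fun j => 'X_(lift ord0 j) - 'X_ord0 ^+ (N ^ lift ord0 j)).
HB.instance Definition _ := GRing.RMorphism.copy of_mpoly
  (mmap (@mpolyC n.+1 D) (fun j => 'X_(lift ord0 j) - 'X_ord0 ^+ (N ^ lift ord0 j))).

Definition of_poly : {poly {mpoly D[n]}} -> {mpoly D[n.+1]} :=
  horner_eval 'X_ord0 \o map_poly of_mpoly.
HB.instance Definition _ := GRing.RMorphism.copy of_poly
  (horner_eval 'X_ord0 \o map_poly of_mpoly).

Lemma to_polyC c : to_poly c%:MP = c%:MP%:P.
Proof. by rewrite /to_poly mmapC. Qed.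

Lemma to_polyX i : to_poly 'X_i = coord_shift i.
Proof. by rewrite /to_poly mmapX mmap1U. Qed.

Lemma of_polyE f : of_poly f = (map_poly of_mpoly f).['X_ord0].
Proof. by []. Qed.

Lemma to_polyK : cancel to_poly of_poly.
Proof.
apply: (@mpoly_rmorph_ext _ _ _ (of_poly \o to_poly) idfun) => [c|i] /=.
  by rewrite to_polyC of_polyE map_polyC hornerC /= /of_mpoly mmapC.
rewrite to_polyX /coord_shift; case: unliftP => [j ->|->].
  rewrite of_polyE rmorphD /= map_polyXn map_polyC hornerD hornerXn hornerC /=.
  by rewrite /of_mpoly mmapX mmap1U addrC subrK.
by rewrite of_polyE map_polyX hornerX.
Qed.

Hypothesis N_gt0 : (0 < N)%N.

Lemma coord_shift_monic i :
  coord_shift i \is monic /\ size (coord_shift i) = (N ^ i).+1.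
Proof.
rewrite /coord_shift; case: unliftP => [j _|->]; last by rewrite monicX size_polyX.
have Ni : (0 < N ^ i)%N by rewrite expn_gt0 N_gt0.
by rewrite size_XnaddC // monicE lead_coefXnaddC.
Qed.

(** The degree in [y] that the monomial acquires under [to_poly]. *)
Definition weight (m : 'X_{1..n.+1}) := (\sum_(i < n.+1) m i * N ^ i)%N.

Lemma to_poly_monomial m :
  to_poly 'X_[m] \is monic /\ size (to_poly 'X_[m]) = (weight m).+1.
Proof.
rewrite /to_poly mmapX /mmap1 /weight.
apply: (big_ind2 (fun (q : {poly {mpoly D[n]}}) w => q \is monic /\ size q = w.+1)).
- by rewrite monic1 size_poly1.
- move=> q w q' w' [mq sq] [mq' sq']; split; first by rewrite monicMl.
  by rewrite size_monicM ?monic_neq0 // sq sq' addnS addSn.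
move=> i _; have [mi si] := coord_shift_monic i; split; first exact: monic_exp.
have := size_exp (coord_shift i) (m i); rewrite si /= mulnC => <-.
by rewrite prednK // size_poly_gt0 expf_neq0 // monic_neq0.
Qed.

End Coordinates.

Lemma seq_argmax (T : eqType) (w : T -> nat) (s : seq T) : s != [::] ->
  exists2 x, x \in s & forall y, y \in s -> (w y <= w x)%N.
Proof.
elim: s => [//|x [|y s] IHs] _; first by exists x => [|z]; rewrite ?inE // => /eqP ->.
have [//|z zs zmax] := IHs; have [le_xz|/ltnW le_zx] := leqP (w x) (w z).
  by exists z => [|t]; rewrite inE ?zs ?orbT // => /predU1P[->|/zmax].
exists x => [|t]; rewrite inE ?eqxx // => /predU1P[->//|/zmax le_tz].
exact: leq_trans le_zx.
Qed.

(* The exponents of [f] are the base-[msize f] digits of the weights of its monomials, so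
   these weights are distinct and a single monomial contributes to the leading term. *)
Lemma lead_coef_to_poly (D : idomainType) n (f : {mpoly D[n.+1]}) : f != 0 ->
  exists m, f@_m != 0 /\ lead_coef (to_poly (msize f) f) = (f@_m)%:MP.
Proof.
move=> f0; set N := msize f.
have N0 : (0 < N)%N by rewrite lt0n mmeasure_poly_eq0.
have [m mf m_max] := @seq_argmax _ (weight N) (msupp f) ltac:(by rewrite msupp_eq0).
exists m; split; first by rewrite -mcoeff_msupp.
have digit m' : m' \in msupp f -> forall i, (m' i < N)%N.
  move=> /msize_mdeg_lt m'f i; apply: leq_ltn_trans m'f.
  by rewrite mdegE (bigD1 i) //= leq_addr.
have termE m' : to_poly N (f@_m' *: 'X_[m']) = (f@_m')%:MP *: to_poly N 'X_[m'].
  by rewrite -mul_mpolyC rmorphM /= to_polyC mul_polyC.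
have [mon_m size_m] := to_poly_monomial D N0 m.
have fm0 : (f@_m)%:MP != 0 :> {mpoly D[n]} by rewrite mpolyC_eq0 -mcoeff_msupp.
rewrite {1}[f]mpolyE rmorph_sum /= (bigD1_seq m) ?msupp_uniq //= termE.
rewrite lead_coefDl; first by rewrite lead_coefZ (monicP mon_m) mulr1.
rewrite size_scale // size_m ltnS big_seq_cond.
apply: (big_ind (fun q : {poly {mpoly D[n]}} => size q <= weight N m)%N) => [|q q' sq sq'|m'].
- by rewrite size_poly0.
- by rewrite (leq_trans (size_polyD _ _)) // geq_max sq sq'.
move=> /andP[m'f neq_m]; rewrite termE; apply: leq_trans (size_scale_leq _ _) _.
have [_ ->] := to_poly_monomial D N0 m'; rewrite ltn_neqAle m_max // andbT.
apply: contra neq_m => /eqP/base_digits_inj eq_m.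
by apply/eqP/mnmP; apply: eq_m; apply: digit.
Qed.

(** * Reduction modulo [p] and induction on the number of variables *)

Lemma mpoly_coeff_modp (K : fieldType) n (p : {poly K}) (f : {mpoly {poly K}[n]}) :
  p != 0 -> exists r q, f = r + p%:MP * q /\ forall m, (size r@_m < size p)%N.
Proof.
move=> p0; elim/mpolyind: f => [|c m f _ _ [r [q [-> sr]]]].
  by exists 0, 0; split=> [|m]; rewrite ?mulr0 ?addr0 // mcoeff0 size_poly0 size_poly_gt0.
exists ((c %% p) *: 'X_[m] + r), ((c %/ p) *: 'X_[m] + q); split.
  rewrite {1}(divp_eq c p) -!mul_mpolyC mpolyCD mpolyCM; ring.
move=> m'; rewrite mcoeffD mcoeffZ mcoeffX (leq_ltn_trans (size_polyD _ _)) // gtn_max sr andbT.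
by case: eqP => _; rewrite ?mulr1 ?mulr0 ?size_poly0 ?size_poly_gt0 ?ltn_modp.
Qed.

Section Induction.
Variables (K : fieldType) (p : {poly K}).
Hypothesis irr_p : irreducible_poly p.

Lemma irreducible_coprime (c : {poly K}) : c != 0 -> (size c < size p)%N ->
  exists a b, a * c + b * p = 1.
Proof.
move=> c0 lt_cp; have [_ irr] := irr_p.
have : coprimep c p.
  rewrite /coprimep; apply/negPn/negP=> /irr /(_ (dvdp_gcdr _ _)) /eqp_size sg.
  by have := dvdp_leq c0 (dvdp_gcdl c p); rewrite sg leqNgt lt_cp.
by case/Bezout_eq1_coprimepP=> [[a b] /= e]; exists a, b.
Qed.

Lemma irreducible_mpoly_nunit n (q : {mpoly {poly K}[n]}) : p%:MP * q <> 1.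
Proof.
move/(congr1 (meval (fun=> 0))); rewrite mevalM mevalC meval1 => e.
have [p1 _] := irr_p; have : p %| 1 by rewrite -e dvdp_mulr.
by rewrite dvdp1 => /eqP p1'; rewrite p1' in p1.
Qed.

(* As [p = det F] lies in the ideal of the first column, so does the remainder [r] modulo [p]
   of an entry of that column. *)
Lemma column_lead_coef n (F : 'M[{mpoly {poly K}[n.+1]}]_2) (r q : {mpoly {poly K}[n.+1]})
    (i : 'I_2) : \det F = p%:MP -> F i 0 = r + p%:MP * q -> r != 0 ->
  (forall m, (size r@_m < size p)%N) ->
  exists N u v a b, a * lead_coef (u * to_poly N (F 0 0) + v * to_poly N (F 1 0))
    + b * (p%:MP : {mpoly {poly K}[n]}) = 1.
Proof.
rewrite det_ord2 => detF Fi r0 sr.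
have [u [v euv]] : exists u v, r = u * F 0 0 + v * F 1 0.
  have [ei|ei] := ord2_cases i; rewrite ei in Fi.
    (* Expand [r = F i 0 - q det F] along the first column. *)
    exists (1 - F 1 1 * q), (F 0 1 * q).
    by apply: (addIr (p%:MP * q)); rewrite -Fi -detF; ring.
  exists (- F 1 1 * q), (1 + F 0 1 * q).
  by apply: (addIr (p%:MP * q)); rewrite -Fi -detF; ring.
have [m [fm lm]] := lead_coef_to_poly r0.
have [a [b ab]] := irreducible_coprime fm (sr m).
exists (msize r), (to_poly (msize r) u), (to_poly (msize r) v), a%:MP, b%:MP.
move: lm; rewrite {2}euv rmorphD !rmorphM /= => ->.
by rewrite -!mpolyCM -mpolyCD ab.
Qed.

(** After the change of variables [F] is equivalent to its value at [y = 0], which has the same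
    determinant and still unimodular entries, so the induction hypothesis applies. *)
Lemma mx_equivalent_step n (F : 'M[{mpoly {poly K}[n.+1]}]_2)
    (r q : {mpoly {poly K}[n.+1]}) (i : 'I_2) :
  (forall G : 'M[{mpoly {poly K}[n]}]_2,
     minors1_ideal G 1 -> \det G = p%:MP -> mx_equivalent G (diag2 1 p%:MP)) ->
  minors1_ideal F 1 -> \det F = p%:MP -> F i 0 = r + p%:MP * q -> r != 0 ->
  (forall m, (size r@_m < size p)%N) -> mx_equivalent F (diag2 1 p%:MP).
Proof.
move=> IHn I1 detF Fi r0 sr.
have [N [u [v [a [b ab]]]]] := column_lead_coef detF Fi r0 sr.
apply: (@mx_equivalent_transport _ _ _ _ _ p%:MP (@to_polyK {poly K} n N)).
rewrite [X in diag2 1 X]to_polyC.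
pose G := map_mx (@to_poly {poly K} n N) F.
have I1G : minors1_ideal G 1 by apply: minors1_ideal_map.
have detG : \det G = (p%:MP)%:P by rewrite det_map_mx detF /= to_polyC.
have eG : mx_equivalent G (map_mx (fun f => f.[0]%:P) G).
  apply: (@equivalent_eval0 _ G p%:MP u v) => //.
  by exists a, b; rewrite !mxE; apply: ab.
apply: (mx_equivalent_trans eG).
have -> : map_mx (fun f => f.[0]%:P) G = map_mx polyC (map_mx (horner_eval 0) G).
  by apply/matrixP=> i' j'; rewrite !mxE.
rewrite -(rmorph1 polyC) -map_diag2; apply/mx_equivalent_map/IHn.
  exact: minors1_ideal_map.
by rewrite det_map_mx detG /= /horner_eval hornerC.
Qed.

Lemma mx_equivalent_mpoly n (F : 'M[{mpoly {poly K}[n]}]_2) :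
  minors1_ideal F 1 -> \det F = p%:MP -> mx_equivalent F (diag2 1 p%:MP).
Proof.
elim: n F => [|n IHn] F I1 detF.
  pose f := meval (fun=> 0) : {rmorphism {mpoly {poly K}[0]} -> {poly K}}.
  have fK : cancel f (@mpolyC 0 {poly K}).
    apply: (@mpoly_rmorph_ext _ _ _ (@mpolyC 0 {poly K} \o f) idfun) => [c|[]//].
    by rewrite /= mevalC.
  apply: (mx_equivalent_transport fK); rewrite /= mevalC.
  by apply: irreducible_diag2 => //; rewrite det_map_mx detF /= mevalC.
have p0 : p != 0 by rewrite -size_poly_gt0; case: irr_p => /ltnW.
have red i j : exists rq : _ * _, F i j = rq.1 + p%:MP * rq.2 /\
    forall m, (size rq.1@_m < size p)%N.
  by have [r [q ?]] := mpoly_coeff_modp (F i j) p0; exists (r, q).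
have [rq rqE] := boolp.choice (fun ij : 'I_2 * 'I_2 => red ij.1 ij.2).
have [r0|/existsPn col0] := boolP [exists i, (rq (i, 0)).1 != 0].
  have [i ri] := existsP r0; have [/= Fi sr] := rqE (i, 0).
  exact: mx_equivalent_step Fi ri sr.
(* The first column vanishes modulo [p]; if the second does not, rotate it into first place. *)
have [r1|/existsPn col1] := boolP [exists i, (rq (i, 1)).1 != 0].
  have [i ri] := existsP r1; have [/= Fi sr] := rqE (i, 1).
  pose V : 'M[{mpoly {poly K}[n.+1]}]_2 := mx2 0 (-1) 1 0.
  have detV : \det V = 1 by rewrite det_mx2; ring.
  have uV : V \in unitmx by rewrite unitmxE detV unitr1.
  have FV : mx_equivalent F (F *m V).
    exists 1%:M, (invmx V).
    by rewrite unitmx1 unitmx_inv uV mul1mx mulmxK.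
  apply: (mx_equivalent_trans FV).
  apply: (mx_equivalent_step (q := (rq (i, 1)).2) (i := i) IHn _ _ _ ri sr).
  - exact: minors1_ideal_rot_cols.
  - by rewrite det_mulmx detF detV mulr1.
  by rewrite -Fi {1}[F]mx2E mulmx2; have [->|->] := ord2_cases i; rewrite !mxE /=; ring.
(* Otherwise [p] divides every entry, hence divides 1. *)
have Fp i j : F i j = p%:MP * (rq (i, j)).2.
  have [/= -> _] := rqE (i, j); suff -> : (rq (i, j)).1 = 0 by rewrite add0r.
  by apply/eqP/negPn; have [->|->] := ord2_cases j.
have [c e1] := I1; case: (@irreducible_mpoly_nunit _ (\sum_ij c ij * (rq ij).2)).
rewrite e1 big_distrr /=; apply: eq_bigr => ij _.
by rewrite Fp -surjective_pairing; ring.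
Qed.

End Induction.

(** * Moving [x_1] into the coefficient ring *)

Section FirstVariable.
Variables (K : fieldType) (n : nat).

Definition split_var (i : 'I_n.+1) : {mpoly {poly K}[n]} :=
  if unlift ord0 i is Some j then 'X_j else ('X)%:MP.

Definition split_first : {mpoly K[n.+1]} -> {mpoly {poly K}[n]} :=
  mmap (@mpolyC n {poly K} \o polyC) split_var.
HB.instance Definition _ := GRing.RMorphism.copy split_first
  (mmap (@mpolyC n {poly K} \o polyC) split_var).

HB.instance Definition _ := GRing.RMorphism.copy (@in_first_var K n)
  (horner_eval ('X_ord0 : {mpoly K[n.+1]}) \o map_poly (@mpolyC n.+1 K)).

Lemma in_first_varC c : in_first_var n c%:P = c%:MP :> {mpoly K[n.+1]}.
Proof. by rewrite /in_first_var map_polyC hornerC. Qed.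

Lemma in_first_varX : in_first_var n 'X = 'X_ord0 :> {mpoly K[n.+1]}.
Proof. by rewrite /in_first_var map_polyX hornerX. Qed.

Definition merge_first : {mpoly {poly K}[n]} -> {mpoly K[n.+1]} :=
  mmap (@in_first_var K n) (fun j => 'X_(lift ord0 j)).
HB.instance Definition _ := GRing.RMorphism.copy merge_first
  (mmap (@in_first_var K n) (fun j => 'X_(lift ord0 j))).

Lemma split_firstK : cancel split_first merge_first.
Proof.
apply: (@mpoly_rmorph_ext _ _ _ (merge_first \o split_first) idfun) => [c|i] /=.
  by rewrite /split_first mmapC /merge_first mmapC /= in_first_varC.
rewrite /split_first mmapX mmap1U /merge_first /split_var; case: unliftP => [j|] ->.
  by rewrite mmapX mmap1U.
by rewrite mmapC /= in_first_varX.
Qed.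

Lemma split_first_in_first_var p : split_first (in_first_var n p) = p%:MP.
Proof.
apply: (@poly_rmorph_ext _ _ (split_first \o @in_first_var K n) (@mpolyC n {poly K}))
  => [c|] /=; first by rewrite in_first_varC /split_first mmapC.
by rewrite in_first_varX /split_first mmapX mmap1U /split_var unlift_none.
Qed.

End FirstVariable.

Theorem theorem3p3 (K : fieldType) (n : nat) (F : 'M[{mpoly K[n.+1]}]_2) (p : {poly K})
    (irr_p : irreducible_poly p)
    (det_F : \det F = in_first_var n p)
    (I1_F : forall a : {mpoly K[n.+1]}, minors1_ideal F a) :
  mx_equivalent F (diag2 1 (in_first_var n p)).
Proof.
apply: (mx_equivalent_transport (@split_firstK K n)); rewrite /= split_first_in_first_var.
apply: mx_equivalent_mpoly => //; first exact: minors1_ideal_map.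
by rewrite det_map_mx det_F /= split_first_in_first_var.
Qed.
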